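(* Let $M$ be a mixed graph of order $n$ and let $P_{R_H}(M,x)=\det(xI-R_H(M))=x^n+a_1x^{n-1}+\cdots+a_n$. Then for each $k$, $$(-1)^k a_k=\sum_{M'}(-1)^{r(M')+l(M')}\,2^{s(M')}\prod_{v_i\in V(M')}\frac{1}{d_{M_U}(v_i)},$$ where the summation is over all real elementary subgraphs $M'$ of $M$ with $k$ vertices, $r(M')=k-c(M')$ with $c(M')$ the number of components of $M'$, $l(M')$ is the number of negative mixed cycles of $M'$, and $s(M')$ is the number of mixed cycles of length $\ge3$ in $M'$.
   Context: A mixed graph $M$ is obtained from a simple undirected graph $M_U$ (its underlying graph) by orienting a subset of its edges; each edge of $M_U$ is either an undirected edge $v_kv_l$ or an arc $(v_k,v_l)$ of $M$. The degree $d_k$ of $v_k$ is its degree in $M_U$. The Hermitian-Randić matrix $R_H(M)=((r_h)_{kl})$ has $(r_h)_{kl}=(r_h)_{lk}=\frac{1}{\sqrt{d_kd_l}}$ if $v_kv_l$ is an undirected edge, $(r_h)_{kl}=-(r_h)_{lk}=\frac{\mathrm{i}}{\sqrt{d_kd_l}}$ if $(v_k,v_l)$ is an arc, and $0$ otherwise. For a mixed cycle $C=v_1\cdots v_lv_1$ (cycle of $M_U$ of length $\ge3$ traversed in a direction) its value is $(r_h)_{12}(r_h)_{23}\cdots(r_h)_{l1}=\epsilon\prod_{v_j\in V(C)}\frac{1}{d(v_j)}$ with $\epsilon\in\{\pm1,\pm\mathrm{i}\}$; it is real if the value is real, positive if $\epsilon=1$, negative if $\epsilon=-1$. An elementary graph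 is one each of whose components is an edge, an arc, or a mixed cycle; an elementary subgraph is real if all its mixed cycles are real. *)

(* Defs.v *)
From HB Require Import structures.
From mathcomp Require Import all_boot all_order all_algebra.

Set Implicit Arguments.
Unset Strict Implicit.
Unset Printing Implicit Defensive.

Import Order.TTheory GRing.Theory Num.Theory.
Local Open Scope ring_scope.

(* [adj] is the underlying simple graph M_U on the vertices 0, ..., n-1; the
   edges that are oriented are those on which [arc] holds in one direction. *)
Record mixed_graph (n : nat) := MixedGraph {
  adj : rel 'I_n;
  arc : rel 'I_n;
  adj_sym : symmetric adj;
  adj_irrefl : irreflexive adj;
  arc_adj : forall x y, arc x y -> adj x y;
  arc_asym : forall x y, arc x y -> ~~ arc y x
}.

Section MixedGraphs.
Variables (n : nat) (M : mixed_graph n).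

Definition undirected (x y : 'I_n) : bool :=
  [&& adj M x y, ~~ arc M x y & ~~ arc M y x].

Definition degree (x : 'I_n) : nat := #|[set y | adj M x y]|.

Definition edges : {set {set 'I_n}} :=
  [set e | [exists x, exists y, adj M x y && (e == [set x; y])]].

End MixedGraphs.

Section HermitianRandic.
Variables (C : numClosedFieldType) (n : nat) (M : mixed_graph n).

Definition hermitian_randic : 'M[C]_n :=
  \matrix_(k, l)
    if undirected M k l then 1 / sqrtC (degree M k * degree M l)%:R
    else if arc M k l then 'i / sqrtC (degree M k * degree M l)%:R
    else if arc M l k then - ('i / sqrtC (degree M k * degree M l)%:R)
    else 0.

(* [c] lists the vertices of a cycle in the order of a traversal; [next c]
   wraps around from the last vertex to the first one. *)
Definition cycle_value (c : seq 'I_n) : C :=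
  \prod_(x <- c) hermitian_randic x (next c x).

Definition real_cycle (c : seq 'I_n) : bool := cycle_value c \is Num.real.

Definition negative_cycle (c : seq 'I_n) : bool :=
  cycle_value c == (-1) * \prod_(x <- c) (1 / (degree M x)%:R).

End HermitianRandic.

(* A subgraph is a pair (vertex set, set of edges of M_U kept); orientations
   are inherited from the ambient mixed graph. *)
Definition subgraph (n : nat) := ({set 'I_n} * {set {set 'I_n}})%type.

Section Subgraphs.
Variables (n : nat) (M : mixed_graph n) (S : subgraph n).

Definition is_subgraph : bool :=
  (S.2 \subset edges M) && [forall e in S.2, e \subset S.1].

Definition sub_adj : rel 'I_n := [rel x y | [set x; y] \in S.2].

Definition components : {set {set 'I_n}} :=
  equivalence_partition (connect sub_adj) S.1.

Definition edge_component (A : {set 'I_n}) : bool :=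
  [exists x, exists y, sub_adj x y && (A == [set x; y])].

(* The edges of the subgraph inside [A] form a cycle through all of [A],
   and [c] traverses it. *)
Definition traverses (A : {set 'I_n}) (c : seq 'I_n) : bool :=
  [&& (3 <= size c)%N, uniq c, A == [set x in c] &
      [set e in S.2 | e \subset A] == [set [set x; next c x] | x in c]].

(* No generality is lost in the length #|A|, since a traversal of [A] lists
   each element of [A] exactly once. *)
Definition cycle_component (A : {set 'I_n}) : bool :=
  [exists c : #|A|.-tuple 'I_n, traverses A c].

Definition elementary : bool :=
  is_subgraph &&
  [forall A in components, edge_component A || cycle_component A].

(* The two directions of traversal have conjugate values, hence a cycle is
   real (negative) in one direction iff it is in the other. *)
Definition real_elementary (C : numClosedFieldType) : bool :=
  elementary &&
  [forall A in components, forall c : #|A|.-tuple 'I_n,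
     traverses A c ==> real_cycle C M c].

Definition num_components : nat := #|components|.

Definition rank : nat := (#|S.1| - num_components)%N.

Definition num_cycles : nat := #|[set A in components | cycle_component A]|.

Definition num_negative_cycles (C : numClosedFieldType) : nat :=
  #|[set A in components | [exists c : #|A|.-tuple 'I_n,
       traverses A c && negative_cycle C M c]]|.

End Subgraphs.

(* Main.v *)
(* Since the diagonal of R_H vanishes, Leibniz's formula expresses (-1)^k a_k as
   the sum, over the permutations s moving exactly k vertices, of the signed
   products of the entries (v, s v) over the moved vertices v. Such a product
   vanishes unless every {v, s v} is an edge, and then these edges form an
   elementary graph on the moved vertices, whose components are the nontrivial
   orbits of s; hence the sign of s is (-1)^r. Conversely every elementary graph
   arises in this way, from the permutations that traverse each of its cycles in
   one of the two directions. As R_H is Hermitian, the two directions of a cycle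
   contribute conjugate values e d and (e d)^*, with e a fourth root of unity and
   d > 0, whose sum is 2d, -2d or 0 according as the cycle is positive, negative or
   not real. *)
Require Import Defs.
From HB Require Import structures.
From mathcomp Require Import all_boot all_order all_fingroup all_algebra.

Set Implicit Arguments.
Unset Strict Implicit.
Unset Printing Implicit Defensive.

Import Order.TTheory GRing.Theory Num.Theory.
Local Open Scope ring_scope.

Definition perm_support (T : finType) (s : {perm T}) : {set T} :=
  [set x | s x != x].

Lemma eq_set2P (T : finType) (a b c d : T) :
  [set a; b] = [set c; d] -> (a = c /\ b = d) \/ (a = d /\ b = c).
Proof.
move=> E; have := set21 a b; have := set22 a b; have := set22 c d.
have := set21 c d; rewrite E -{1 2}E !inE.
by do 4![case/orP => /eqP ?]; subst; auto.
Qed.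

(** * Characteristic polynomials of matrices with zero diagonal *)

Section CharPolyZeroDiagonal.
Variables (R : comNzRingType) (n : nat) (A : 'M[R]_n).

(** In Leibniz's formula each fixed point contributes a factor ['X], because the diagonal vanishes,
    and each moved point contributes the constant [- A v (s v)]. *)
Lemma char_poly_zero_diag : (forall i, A i i = 0) ->
  char_poly A =
  \sum_(s : {perm 'I_n})
     ((-1) ^+ s * \prod_(v in perm_support s) (- A v (s v))) *:
     'X^(n - #|perm_support s|).
Proof.
move=> A0; rewrite /char_poly /determinant; apply: eq_bigr => s _.
rewrite (bigID (mem (perm_support s))) /=.
rewrite (eq_bigr (fun i => (- A i (s i))%:P)); last first.
  by move=> i; rewrite inE => si; rewrite !mxE eq_sym (negPf si) sub0r polyCN.
rewrite [X in _ * (_ * X)](eq_bigr (fun=> 'X)); last first.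
  by move=> i; rewrite !inE negbK => /eqP si; rewrite !mxE si eqxx A0 subr0.
rewrite prodr_const -rmorph_prod.
have -> : #|[pred i | i \notin perm_support s]| = (n - #|perm_support s|)%N.
  by rewrite -[X in (X - _)%N](card_ord n) -(cardC (mem (perm_support s))) addKn.
by rewrite mulrA -mul_polyC rmorphM rmorph_sign.
Qed.

(** Only permutations moving exactly [k] points reach degree [n - k]; the signs of their [k] negated
    entries cancel [(-1) ^+ k]. *)
Lemma coef_char_poly_zero_diag k : (forall i, A i i = 0) -> (k <= n)%N ->
  (-1) ^+ k * (char_poly A)`_(n - k) =
  \sum_(s : {perm 'I_n} | #|perm_support s| == k)
     (-1) ^+ s * \prod_(v in perm_support s) A v (s v).
Proof.
move=> A0 kn; rewrite char_poly_zero_diag // coef_sum mulr_sumr [RHS]big_mkcond.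
apply: eq_bigr => s _; rewrite coefZ coefXn.
have sn : (#|perm_support s| <= n)%N.
  by rewrite -[X in (_ <= X)%N](card_ord n) max_card.
(* Truncated subtraction from [n] is injective here because both numbers are at most [n]. *)
have -> : (n - k == n - #|perm_support s|)%N = (#|perm_support s| == k).
  by apply/eqP/eqP => [|->//]; rewrite -{2}(subKn sn) => <-; rewrite subKn.
case: eqP => [<-|_]; last by rewrite !mulr0.
by rewrite mulr1 prodrN mulrCA signrMK.
Qed.

End CharPolyZeroDiagonal.

(** * Edge sets of permutations *)

Lemma next_traject_porbit (T : finType) (s : {perm T}) x y :
  y \in porbit s x -> next (traject s x #|porbit s x|) y = s y.
Proof.
rewrite porbit_traject => yx; apply/esym/eqP.
apply: (@next_cycle _ (frel s)) => //.
(* The trajectory closes up: iterating [s] as often as the orbit has points returns to [x]. *)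
have := iter_porbit s x; case: #|_| (card_porbit_neq0 s x) => // m _ E.
rewrite /= -[X in rcons _ X]E iterSr -trajectSr.
exact: fpath_traject.
Qed.

Section EdgesOfOrbits.
Variables (T : finType).
Implicit Types s t : {perm T}.

Lemma porbit_next s x y : (s y \in porbit s x) = (y \in porbit s x).
Proof.
by rewrite -!eq_porbit_mem; have /= -> := porbit_perm s 1 y.
Qed.

Lemma porbit_prev s x y : (s^-1%g y \in porbit s x) = (y \in porbit s x).
Proof. by rewrite -porbit_next permKV. Qed.

Definition orbit_edges s (A : {set T}) := [set [set v; s v] | v in A].

Lemma orbit_edgesV s x :
  orbit_edges s^-1 (porbit s x) = orbit_edges s (porbit s x).
Proof.
apply/setP => e; apply/imsetP/imsetP => -[v vx ->].
  by exists (s^-1%g v); rewrite ?porbit_prev // permKV setUC.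
by exists (s v); rewrite ?porbit_next // permK setUC.
Qed.

Lemma mem_orbit_edges s x v w : [set v; w] \in orbit_edges s (porbit s x) ->
  v \in porbit s x /\ (w = s v \/ w = s^-1%g v).
Proof.
case/imsetP => u ux /eq_set2P [[-> ->]|[-> ->]]; first by auto.
by rewrite permK porbit_next; auto.
Qed.

(** The edge from [s v] to [t (s v)] leads either to [s (s v)] or back to [v]. In the second case
    [t] swaps [v] and [s v], and the edge of [v] and [s^-1 v] can come from [t] only if
    [s^-1 v = s v]; then [s (s v) = v] and the two alternatives agree. *)
Lemma same_edges_step s t x v :
  orbit_edges t (porbit s x) = orbit_edges s (porbit s x) ->
  v \in porbit s x -> t v = s v -> t (s v) = s (s v).
Proof.
move=> E vx tv.
have /mem_orbit_edges[_]: [set s v; t (s v)] \in orbit_edges s (porbit s x).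
  by rewrite -E; apply/imsetP; exists (s v); rewrite ?porbit_next.
case=> //; rewrite permK => tsv.
have : [set v; s^-1%g v] \in orbit_edges t (porbit s x).
  by rewrite E -orbit_edgesV; apply/imsetP; exists v.
case/imsetP => w _ /eq_set2P[[<- E2]|[E1 E2]].
  by rewrite tv in E2; rewrite tsv -E2 permKV.
have E3 : s^-1%g v = s v by apply: (@perm_inj _ t); rewrite E2 -E1 tsv.
by rewrite tsv -E3 permKV.
Qed.

Lemma same_edges_orbit s t x :
  orbit_edges t (porbit s x) = orbit_edges s (porbit s x) ->
  t x = s x -> {in porbit s x, t =1 s}.
Proof.
move=> E tx y /porbitP[i ->] {y}.
elim: i => [|i IH]; first by rewrite expg0 perm1.
by rewrite expgSr permM; apply: (same_edges_step E) => //; apply: mem_porbit.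
Qed.

(** The edge at [x] forces [t x] to be [s x] or [s^-1 x], and this choice propagates along the
    orbit. The second case is the first one for [s^-1], which has the same orbits and edges. *)
Lemma same_edges_orient s t x :
  orbit_edges t (porbit s x) = orbit_edges s (porbit s x) ->
  {in porbit s x, t =1 s} \/ {in porbit s x, t =1 s^-1%g}.
Proof.
move=> E.
have /mem_orbit_edges[_]: [set x; t x] \in orbit_edges s (porbit s x).
  by rewrite -E; apply/imsetP; exists x; rewrite ?porbit_id.
case=> tx; first by left; apply: same_edges_orbit.
by right; rewrite -porbitV; apply: same_edges_orbit; rewrite ?porbitV ?orbit_edgesV.
Qed.

End EdgesOfOrbits.

(** * Graphs of permutations: components and sign *)

Definition perm_graph (n : nat) (s : {perm 'I_n}) : subgraph n :=
  (perm_support s, orbit_edges s (perm_support s)).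

Section PermGraph.
Variable n : nat.
Implicit Types (s t : {perm 'I_n}) (x y : 'I_n).

Lemma porbit_support s x y : y \in porbit s x ->
  (y \in perm_support s) = (x \in perm_support s).
Proof.
case/porbitP => i ->; rewrite !inE -permM -expgSr expgS permM.
by rewrite (inj_eq perm_inj).
Qed.

Lemma card_porbit_support s x : x \in perm_support s -> (1 < #|porbit s x|)%N.
Proof.
rewrite inE => sx; have <- : #|[set x; s x]| = 2%N by rewrite cards2 eq_sym sx.
by apply/subset_leq_card; rewrite subUset !sub1set porbit_id porbit_next porbit_id.
Qed.

Lemma sub_adj_graph s x y : sub_adj (perm_graph s) x y ->
  (x \in perm_support s) && ((y == s x) || (y == s^-1%g x)).
Proof.
case/imsetP => v vs /eq_set2P[[-> ->]|[-> ->]]; first by rewrite vs eqxx.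
by rewrite permK eqxx orbT (porbit_support (x := v)) ?vs ?porbit_next ?porbit_id.
Qed.

Lemma sub_adj_graph_next s x : x \in perm_support s ->
  sub_adj (perm_graph s) x (s x).
Proof. by move=> xs; apply/imsetP; exists x. Qed.

Lemma connect_graph s x y : connect (sub_adj (perm_graph s)) x y = (y \in porbit s x).
Proof.
apply/idP/idP => [/connectP[p]|/porbitP[i ->]].
  elim: p x => [|z p IH] x /=; first by move=> _ ->; apply: porbit_id.
  case/andP => /sub_adj_graph/andP[_ xz] zp /(IH _ zp).
  suff /eqP -> : porbit s z == porbit s x by [].
  rewrite eq_porbit_mem.
  by case/orP: xz => /eqP ->; rewrite ?porbit_next ?porbit_prev porbit_id.
elim: i => [|i IH]; first by rewrite expg0 perm1.
apply: connect_trans IH _; rewrite expgSr permM; set z := (s ^+ i)%g x.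
(* A fixed point carries no edge, but there the step from [z] to [s z] is trivial. *)
have [zs|] := boolP (z \in perm_support s).
  by apply/connect1/sub_adj_graph_next.
by rewrite inE negbK => /eqP ->.
Qed.

Lemma components_graph s :
  components (perm_graph s) = [set porbit s x | x in perm_support s].
Proof.
apply: eq_in_imset => x xs; apply/setP => y; rewrite !inE connect_graph.
by case: (boolP (y \in porbit s x)) => [/porbit_support|];
  rewrite ?andbF // !inE => ->; rewrite inE in xs; rewrite xs.
Qed.

Lemma component_graphP s A : reflect
  (exists2 x, x \in perm_support s & A = porbit s x) (A \in components (perm_graph s)).
Proof. by rewrite components_graph; apply: imsetP. Qed.

Lemma partition_graph s : partition (components (perm_graph s)) (perm_support s).
Proof.
apply: equivalence_partitionP => x y z _ _ _; rewrite !connect_graph porbit_id.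
by split=> //; rewrite -!eq_porbit_mem => /eqP ->.
Qed.

(** The parity of [s] is that of [n] minus the number of all orbits. Each fixed point adds one to
    both numbers, so only the support and its nontrivial orbits matter. *)
Lemma odd_perm_rank s : odd_perm s = odd (rank (perm_graph s)).
Proof.
rewrite /rank /num_components components_graph /=; set S := perm_support s.
have fixed x : x \notin S -> porbit s x = [set x].
  rewrite inE negbK => /eqP sx; apply/setP => y; rewrite inE.
  apply/porbitP/eqP => [[i ->]|->]; last by exists 0; rewrite expg0 perm1.
  by elim: i => [|i IH]; rewrite ?expg0 ?perm1 // expgSr permM IH.
have Ep : porbits s = [set porbit s x | x in S] :|: [set [set x] | x in ~: S].
  apply/setP => A; rewrite inE; apply/imsetP/orP => [[x _ ->]|].
    have [xS|xS] := boolP (x \in S); first by left; apply: imset_f.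
    by right; rewrite (fixed x xS) imset_f // inE.
  by case=> /imsetP[x xS ->]; exists x => //; rewrite fixed // -in_setC.
rewrite /odd_perm Ep oddB; last exact: leq_imset_card.
rewrite cardsU (_ : _ :&: _ = set0) ?cards0 ?subn0; last first.
  apply/setP => A; rewrite !inE; apply/andP => -[/imsetP[x xS ->] /imsetP[y _ E]].
  by have := card_porbit_support xS; rewrite E cards1.
rewrite (card_imset _ set1_inj) -(cardsC S) !oddD.
by do 3!case: (odd _).
Qed.

End PermGraph.

(** * Elementary graphs *)

Section ElementaryGraphs.
Variables (n : nat) (M : mixed_graph n).
Implicit Types (s t : {perm 'I_n}) (x y : 'I_n) (A : {set 'I_n}) (S : subgraph n).

Lemma mem_edges x y : ([set x; y] \in edges M) = adj M x y.
Proof.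
rewrite inE; apply/existsP/idP => [[u /existsP[v /andP[uv /eqP]]]|xy].
  by case/eq_set2P => -[-> ->] //; rewrite adj_sym.
by exists x; apply/existsP; exists y; rewrite xy eqxx.
Qed.

Lemma component_edges s x : x \in perm_support s ->
  [set e in (perm_graph s).2 | e \subset porbit s x] = orbit_edges s (porbit s x).
Proof.
move=> xs; apply/setP => e; rewrite inE; apply/andP/imsetP.
  case=> /imsetP[v vs ->]; rewrite subUset !sub1set => /andP[vx _].
  by exists v.
case=> v vx ->; rewrite subUset !sub1set porbit_next vx; split=> //.
by apply/imsetP; exists v; rewrite ?(porbit_support vx).
Qed.

Lemma traverses_traject s x : x \in perm_support s -> (2 < #|porbit s x|)%N ->
  traverses (perm_graph s) (porbit s x) (traject s x #|porbit s x|).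
Proof.
move=> xs x3; rewrite /traverses size_traject x3 uniq_traject_porbit.
have Ex : porbit s x = [set y in traject s x #|porbit s x|].
  by apply/setP => y; rewrite inE porbit_traject.
rewrite -Ex eqxx component_edges //=; apply/eqP.
rewrite /orbit_edges {1}Ex; apply/setP => e; apply/imsetP/imsetP => -[v].
  by rewrite inE => vx ->; exists v; rewrite // next_traject_porbit // porbit_traject.
by move=> vx ->; exists v; rewrite ?inE // next_traject_porbit // porbit_traject.
Qed.

Lemma cycle_component_graph s x : x \in perm_support s ->
  cycle_component (perm_graph s) (porbit s x) = (2 < #|porbit s x|)%N.
Proof.
move=> xs; apply/existsP/idP => [[c /and4P[+ _ _ _]]|x3]; first by rewrite size_tuple.
have c_size : size (traject s x #|porbit s x|) == #|porbit s x| by rewrite size_traject.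
by exists (Tuple c_size); apply: traverses_traject.
Qed.

(** As [c] is duplicate-free, [next c] is a permutation; it has the same edges as [s] on the orbit,
    so [same_edges_orient] applies. *)
Lemma traverses_orient s x c : x \in perm_support s ->
  traverses (perm_graph s) (porbit s x) c ->
  {in porbit s x, next c =1 s} \/ {in porbit s x, next c =1 s^-1%g}.
Proof.
move=> xs /and4P[_ c_uniq /eqP Ac /eqP Ec].
have next_inj : injective (next c) by apply/can_inj/prev_next.
have nextE : perm next_inj =1 next c by apply: permE.
have [|tE|tE] := @same_edges_orient _ s (perm next_inj) x.
- rewrite -component_edges // Ec /orbit_edges Ac.
  apply/setP => e; apply/imsetP/imsetP => -[v vc ->]; exists v => //.
  + by rewrite inE in vc.
  + by rewrite nextE.
  + by rewrite inE.
  + by rewrite nextE.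
- by left=> v vx; rewrite -nextE tE.
- by right=> v vx; rewrite -nextE tE.
Qed.

(** The shape of the components is automatic: they are the nontrivial orbits, and an orbit of two
    points is an edge while a longer one is a cycle. *)
Lemma elementary_graph s :
  elementary M (perm_graph s) = [forall v in perm_support s, adj M v (s v)].
Proof.
apply/andP/forall_inP => [[/andP[/subsetP sE _] _] v vs|adj_s].
  by rewrite -mem_edges; apply: sE; apply/imsetP; exists v.
split.
  apply/andP; split.
    by apply/subsetP => e /imsetP[v vs ->]; rewrite mem_edges adj_s.
  apply/forall_inP => e /imsetP[v vs ->]; rewrite subUset !sub1set vs /=.
  by rewrite (porbit_support (x := v)) ?porbit_next ?porbit_id.
apply/forall_inP => A /component_graphP[x xs ->].
have [x3|x2] := ltnP 2 #|porbit s x|; first by rewrite cycle_component_graph // x3 orbT.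
apply/orP; left; apply/existsP; exists x; apply/existsP; exists (s x).
rewrite sub_adj_graph_next //= eq_sym eqEcard subUset !sub1set porbit_next.
by rewrite porbit_id (leq_trans x2) // cards2; rewrite inE in xs; rewrite eq_sym xs.
Qed.

Lemma connect_components S : {in S.1 & &, equivalence_rel (connect (sub_adj S))}.
Proof.
have sub_sym : connect_sym (sub_adj S).
  by apply: sym_connect_sym => u v; rewrite /sub_adj /= [in LHS]setUC.
by move=> x y z _ _ _; rewrite connect0; split=> // xy; rewrite (same_connect sub_sym xy).
Qed.

Lemma partition_components S : partition (components S) S.1.
Proof. exact/equivalence_partitionP/connect_components. Qed.

(** Treats edges and cycles uniformly: an edge is traversed by the list of its two ends, on which
    [next] is the swap. Only the length bound of [traverses] is dropped. *)
Lemma elementary_traversal S A : elementary M S -> A \in components S ->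
  exists c : seq 'I_n, [&& uniq c, A == [set x in c] &
    [set e in S.2 | e \subset A] == [set [set x; next c x] | x in c]].
Proof.
case/andP => /andP[/subsetP SE _] /forall_inP/(_ A)/[swap] AS /(_ AS)/orP[].
  case/existsP=> x /existsP[y /andP[xy /eqP A_xy]]; exists [:: x; y].
  have xy_adj : adj M x y by rewrite -mem_edges SE.
  have xy_neq : x != y by apply: contraTneq xy_adj => ->; rewrite adj_irrefl.
  have next_x : next [:: x; y] x = y by rewrite /= eqxx.
  have next_y : next [:: x; y] y = x by rewrite /= [y == x]eq_sym (negPf xy_neq) eqxx.
  apply/and3P; split; first by rewrite /= inE xy_neq.
    by apply/eqP/setP => z; rewrite A_xy !inE.
  apply/eqP/setP => e; rewrite inE; apply/andP/imsetP.
    case=> eS; have := SE _ eS; rewrite inE => /existsP[u /existsP[v /andP[uv /eqP eE]]].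
    have uv_neq : u != v by apply: contraTneq uv => ->; rewrite adj_irrefl.
    rewrite eE A_xy subUset !sub1set !inE => /andP[/orP[]/eqP uE /orP[]/eqP vE].
    - by rewrite uE vE eqxx in uv_neq.
    - by exists x; rewrite ?next_x ?uE ?vE // inE eqxx.
    - by exists y; rewrite ?next_y ?uE ?vE // !inE eqxx orbT.
    - by rewrite uE vE eqxx in uv_neq.
  case=> z; rewrite !inE => /orP[]/eqP-> ->; rewrite ?next_x ?next_y.
    by split=> //; rewrite A_xy.
  by rewrite setUC; split=> //; rewrite A_xy.
by case/existsP=> c /and4P[_ cU cA cE]; exists c; apply/and3P.
Qed.

(** Choosing one traversal per component and following it, with all other vertices fixed, gives a
    permutation with graph [S]. *)
Lemma elementary_perm_graph S : elementary M S -> exists s, S = perm_graph s.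
Proof.
move=> elS; have /andP[/andP[/subsetP SE /forall_inP Ssub] _] := elS.
have /and3P[/eqP cov triv nz] := partition_components S.
have /fin_all_exists[f fP] : forall A, exists c : seq 'I_n,
    (A \in components S) ==> [&& uniq c, A == [set x in c] &
    [set e in S.2 | e \subset A] == [set [set x; next c x] | x in c]].
  move=> A; have [AS|_] := boolP (A \in _); last by exists [::].
  by have [c cP] := elementary_traversal elS AS; exists c.
pose blk := pblock (components S).
pose g v := if v \in S.1 then next (f (blk v)) v else v.
have blkE v w : w \in blk v -> blk w = blk v by apply: same_pblock.
have blkP v : v \in S.1 -> blk v \in components S.
  by move=> vS; apply: pblock_mem; rewrite cov.
have fU v : v \in S.1 -> uniq (f (blk v)).
  by move=> /blkP vB; have /implyP/(_ vB)/and3P[] := fP (blk v).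
have fA v : v \in S.1 -> blk v = [set x in f (blk v)].
  by move=> /blkP vB; have /implyP/(_ vB)/and3P[_ /eqP] := fP (blk v).
have fE v : v \in S.1 -> [set e in S.2 | e \subset blk v] =
    [set [set x; next (f (blk v)) x] | x in f (blk v)].
  by move=> /blkP vB; have /implyP/(_ vB)/and3P[_ _ /eqP] := fP (blk v).
have mem_f v w : v \in S.1 -> (w \in f (blk v)) = (w \in blk v).
  by move=> vS; rewrite [in RHS]fA // inE.
have blk_id v : v \in S.1 -> v \in blk v by rewrite mem_pblock cov.
have g_blk v : v \in S.1 -> g v \in blk v.
  by move=> vS; rewrite /g vS -mem_f // mem_next mem_f // blk_id.
have blk_sub v w : v \in S.1 -> w \in blk v -> w \in S.1.
  by move=> vS wv; rewrite -cov -mem_pblock -/(blk w) (blkE _ _ wv).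
have gS v : (g v \in S.1) = (v \in S.1).
  apply/idP/idP => [|vS]; last by apply: blk_sub (g_blk _ vS).
  by rewrite /g; case: (boolP (v \in S.1)) => // /negPf ->.
(* Since [g] preserves blocks, two vertices with the same image lie in one block, where [next] is
   injective. *)
have g_inj : injective g.
  move=> v w gE; have vw : (v \in S.1) = (w \in S.1) by rewrite -gS gE gS.
  have [vS|vS] := boolP (v \in S.1); last by move: gE; rewrite /g -vw (negPf vS).
  have wS : w \in S.1 by rewrite -vw.
  have bE : blk v = blk w.
    by rewrite -(blkE _ _ (g_blk _ vS)) gE (blkE _ _ (g_blk _ wS)).
  move: gE; rewrite /g vS wS bE; exact: (can_inj (prev_next (fU _ wS))).
have gE2 v : v \in S.1 -> [set v; g v] \in S.2.
  move=> vS; have : [set v; g v] \in [set e in S.2 | e \subset blk v].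
    rewrite fE //; apply/imsetP; exists v; first by rewrite mem_f // blk_id.
    by rewrite /g vS.
  by rewrite inE => /andP[].
have suppE : perm_support (perm g_inj) = S.1.
  apply/setP => v; rewrite inE permE; apply/idP/idP => [|vS].
    by apply: contraNT => vS; rewrite /g (negPf vS).
  have : adj M v (g v) by rewrite -mem_edges SE // gE2.
  by apply: contraTneq => ->; rewrite adj_irrefl.
exists (perm g_inj); rewrite [S in LHS]surjective_pairing /perm_graph suppE.
congr (_, _); apply/setP => e; apply/idP/imsetP => [eS|[v vS ->]]; last first.
  by rewrite permE gE2.
have := SE _ eS; rewrite inE => /existsP[x /existsP[y /andP[_ /eqP eE]]].
have := Ssub _ eS; rewrite eE subUset !sub1set => /andP[xS yS].
(* The ends of an edge of [S] are connected by it, so every edge lies inside one block and is seen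
   by the chosen traversal. *)
have yx : y \in blk x.
  rewrite (pblock_equivalence_partition (@connect_components S)) //.
  by apply: connect1; rewrite /sub_adj /= -eE.
have : e \in [set e in S.2 | e \subset blk x].
  by rewrite inE eS eE subUset !sub1set blk_id.
rewrite fE // => /imsetP[z]; rewrite mem_f // => zx eE'.
have zS := blk_sub _ _ xS zx.
by exists z; rewrite // -eE eE' permE /g zS (blkE _ _ zx).
Qed.

End ElementaryGraphs.

(** * Permutations with a given graph *)

(** Among nontrivial orbits, those of two points are exactly the ones whose two directions
    coincide. *)
Lemma card_porbit_le2 (T : finType) (s : {perm T}) x : x \in perm_support s ->
  (#|porbit s x| <= 2)%N = (s^-1%g x == s x).
Proof.
rewrite inE => sx; have card_xsx : #|[set x; s x]| = 2%N by rewrite cards2 eq_sym sx.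
have sub_xsx : [set x; s x] \subset porbit s x.
  by rewrite subUset !sub1set porbit_next porbit_id.
apply/idP/eqP => [x2|ssx].
  have xE : [set x; s x] = porbit s x by apply/eqP; rewrite eqEcard sub_xsx card_xsx.
  have : s^-1%g x \in porbit s x by rewrite porbit_prev porbit_id.
  rewrite -xE !inE => /orP[]/eqP // xx.
  by rewrite -[X in s X]xx permKV eqxx in sx.
rewrite -card_xsx; apply/subset_leq_card/subsetP => y /porbitP[i ->].
elim: i => [|i]; first by rewrite expg0 perm1 set21.
rewrite expgSr permM !inE => /orP[]/eqP ->; first by rewrite eqxx orbT.
by rewrite -ssx permKV eqxx.
Qed.

Section Reorientation.
Variables (n : nat) (s : {perm 'I_n}).
Implicit Types (t : {perm 'I_n}) (x y v : 'I_n) (A : {set 'I_n}) (T : {set {set 'I_n}}).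

(** [T] is the set of orbits to be reversed. *)
Definition reorient_fun T v := if porbit s v \in T then s^-1%g v else s v.

Lemma porbit_reorient T v : porbit s (reorient_fun T v) = porbit s v.
Proof.
apply/eqP; rewrite /reorient_fun eq_porbit_mem.
by case: ifP; rewrite ?porbit_prev ?porbit_next porbit_id.
Qed.

Lemma reorient_inj T : injective (reorient_fun T).
Proof.
move=> v w E; have vw : porbit s v = porbit s w.
  by rewrite -(porbit_reorient T) E porbit_reorient.
by move: E; rewrite /reorient_fun vw; case: ifP => _; apply: perm_inj.
Qed.

Definition reorient T : {perm 'I_n} := perm (@reorient_inj T).

Definition long_orbits : {set {set 'I_n}} :=
  [set A in components (perm_graph s) | (2 < #|A|)%N].

(** Restricting to long orbits makes the reversed set unique, since reversing an orbit of two points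
    changes nothing. *)
Definition reversed_orbits t : {set {set 'I_n}} :=
  [set A in long_orbits | [exists v in A, t v != s v]].

Lemma reorient_support T : perm_support (reorient T) = perm_support s.
Proof.
apply/setP => v; rewrite !inE permE /reorient_fun; case: ifP => // _.
by rewrite -(inj_eq (@perm_inj _ s)) permKV eq_sym.
Qed.

Lemma perm_graph_reorient T : perm_graph (reorient T) = perm_graph s.
Proof.
rewrite /perm_graph reorient_support; congr (_, _).
apply/setP => e; apply/imsetP/imsetP => -[v vs ->].
  rewrite permE /reorient_fun; case: ifP => _; last by exists v.
  exists (s^-1%g v); last by rewrite permKV setUC.
  by rewrite (porbit_support (x := v)) // porbit_prev porbit_id.
case: (boolP (porbit s v \in T)) => vT; last first.
  by exists v; rewrite // permE /reorient_fun (negPf vT).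
have svv : s v \in porbit s v by rewrite porbit_next porbit_id.
exists (s v); first by rewrite (porbit_support svv).
have /eqP E : porbit s (s v) == porbit s v by rewrite eq_porbit_mem.
by rewrite permE /reorient_fun E vT permK setUC.
Qed.

Lemma perm_graph_orient t x : perm_graph t = perm_graph s -> x \in perm_support s ->
  {in porbit s x, t =1 s} \/ {in porbit s x, t =1 s^-1%g}.
Proof.
move=> Ets xs; apply: same_edges_orient.
have porbitE : porbit t x = porbit s x.
  by apply/setP => y; rewrite -!connect_graph Ets.
have xt : x \in perm_support t by case: Ets => ->.
by rewrite -(component_edges xs) -{1}porbitE -(component_edges xt) Ets porbitE.
Qed.

(** On each nontrivial orbit [t] is [s] or [s^-1]. If it is [s^-1] on a long orbit, that orbit is
    recorded as reversed; on a short one both agree. *)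
Lemma reorient_reversed t : perm_graph t = perm_graph s ->
  reorient (reversed_orbits t) = t.
Proof.
move=> Ets; apply/permP => v; rewrite permE /reorient_fun.
have [vs|vs] := boolP (v \in perm_support s); last first.
  have tv : t v = v.
    by case: Ets => st _; rewrite -st inE negbK in vs; apply/eqP.
  have sv : s v = v by rewrite inE negbK in vs; apply/eqP.
  by rewrite -[in s^-1%g v]sv permK sv tv if_same.
have vC : porbit s v \in components (perm_graph s).
  by apply/component_graphP; exists v.
rewrite [_ \in reversed_orbits t]inE [_ \in long_orbits]inE vC /=.
have [tE|tE] := perm_graph_orient Ets vs.
  have -> : [exists w in porbit s v, t w != s w] = false.
    by apply/existsP => -[w /andP[/tE ->]]; rewrite eqxx.
  by rewrite andbF tE ?porbit_id.
rewrite tE ?porbit_id //; case: ltnP => [_|] /=; last first.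
  by rewrite card_porbit_le2 // => /eqP.
have [//|] := boolP [exists w in porbit s v, t w != s w].
by rewrite negb_exists => /forallP/(_ v); rewrite porbit_id negbK tE ?porbit_id // => /eqP.
Qed.

Lemma reversed_reorient T : T \subset long_orbits ->
  reversed_orbits (reorient T) = T.
Proof.
move=> /subsetP TP; apply/setP => A; rewrite inE; apply/andP/idP.
  case=> AP /existsP[v /andP[vA]]; rewrite permE /reorient_fun.
  suff -> : A = porbit s v by case: ifP => //; rewrite eqxx.
  move: AP; rewrite inE => /andP[/component_graphP[x _ Ax] _].
  by apply/esym/eqP; rewrite Ax eq_porbit_mem -Ax.
move=> AT; have AP := TP _ AT; split=> //.
move: AP; rewrite inE => /andP[/component_graphP[x xs Ax] A3].
apply/existsP; exists x; rewrite Ax porbit_id /= permE /reorient_fun -Ax AT.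
by rewrite -card_porbit_le2 // -Ax -ltnNge.
Qed.

(* Expanding the product over the components chooses a direction of traversal on
   each cycle of length at least 3. *)
Lemma sum_perm_graph (R : comNzRingType) (w : 'I_n -> 'I_n -> R) :
  \sum_(t | perm_graph t == perm_graph s) \prod_(v in perm_support s) w v (t v) =
  \prod_(A in components (perm_graph s))
    ((if (2 < #|A|)%N then \prod_(v in A) w v (s^-1%g v) else 0) +
     \prod_(v in A) w v (s v)).
Proof.
set comps := components _.
(* With [F] equal to 0 off the long orbits and [G] equal to 1 off the components, the product can
   run over all sets, and distributivity yields a sum over all [T]. *)
pose F A := if A \in long_orbits then \prod_(v in A) w v (s^-1%g v) else 0.
pose G A := if A \in comps then \prod_(v in A) w v (s v) else 1.
transitivity (\prod_(A : {set 'I_n}) (F A + G A)); last first.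
  rewrite [RHS]big_mkcond; apply: eq_bigr => A _; rewrite /F /G inE -/comps.
  by case: (A \in comps) => //=; rewrite add0r.
rewrite bigA_distr (reindex_onto reorient reversed_orbits); last first.
  by move=> t /eqP /reorient_reversed.
rewrite (eq_bigl (fun T => T \subset long_orbits)); last first.
  move=> T; rewrite perm_graph_reorient eqxx /=; apply/eqP/idP => [<-|].
    by apply/subsetP => A; rewrite inE => /andP[].
  exact: reversed_reorient.
(* A choice [T] containing anything but long orbits picks up a zero factor. *)
rewrite big_mkcond; apply: eq_bigr => T _; case: ifPn => [/subsetP TP|]; last first.
  case/subsetPn => A AT AP; rewrite (bigD1 A) //= AT /F (negPf AP) mul0r //.
rewrite (set_partition_big _ (partition_graph s)) -/comps big_mkcond /=.
apply: eq_bigr => A _; case: (boolP (A \in T)) => AT.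
  have AP := TP _ AT; rewrite /F AP; move: (AP); rewrite inE => /andP[AC _].
  rewrite -/comps in AC; rewrite AC; apply: eq_bigr => v vA; rewrite permE.
  rewrite /reorient_fun; move/component_graphP: AC => [x _ Ax].
  suff -> : porbit s v = A by rewrite AT.
  by apply/eqP; rewrite Ax eq_porbit_mem -Ax.
rewrite /G; case: ifP => // AC; apply: eq_bigr => v vA; rewrite permE.
rewrite /reorient_fun; move/component_graphP: AC => [x _ Ax].
suff -> : porbit s v = A by rewrite (negPf AT).
by apply/eqP; rewrite Ax eq_porbit_mem -Ax.
Qed.

End Reorientation.

(** * Values of mixed cycles *)

Section Values.
Variables (C : numClosedFieldType) (n : nat) (M : mixed_graph n).
Implicit Types (s : {perm 'I_n}) (x y v : 'I_n) (A : {set 'I_n}) (c : seq 'I_n).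
Local Notation H := (hermitian_randic C M).

(** The entry of the matrix stripped of its degree factor. *)
Definition unit_entry x y : C :=
  if undirected M x y then 1 else if Defs.arc M x y then 'i
  else if Defs.arc M y x then - 'i else 0.

Lemma hermitian_randicE x y :
  H x y = unit_entry x y * ((sqrtC (degree M x)%:R)^-1 * (sqrtC (degree M y)%:R)^-1).
Proof.
rewrite mxE /unit_entry natrM sqrtCM ?qualifE /= ?ler0n // invfM.
by do 3?case: ifP => _; rewrite ?mul0r // mulNr.
Qed.

Lemma hermitian_randic_conj x y : (H x y)^* = H y x.
Proof.
have d0 z : (sqrtC (degree M z)%:R)^-1^* = (sqrtC (degree M z)%:R)^-1 :> C.
  by apply: geC0_conj; rewrite invr_ge0 sqrtC_ge0 ler0n.
rewrite !hermitian_randicE !rmorphM /= !d0 [X in _ * X]mulrC; congr (_ * _).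
rewrite /unit_entry /undirected [adj M y x]adj_sym.
have := @arc_asym _ M x y.
case: (adj M x y); case: (Defs.arc M x y); case: (Defs.arc M y x) => //= H0;
  rewrite ?conjC1 ?conjC0 ?rmorphN /= ?conjCi ?opprK //.
all: by have := H0 isT.
Qed.

Lemma hermitian_randic_nonadj x y : ~~ adj M x y -> H x y = 0.
Proof.
move=> xy; rewrite mxE /undirected (negPf xy) /=.
rewrite (negPf (contra (@arc_adj _ M x y) xy)).
by rewrite adj_sym in xy; rewrite (negPf (contra (@arc_adj _ M y x) xy)).
Qed.

Lemma unit_entry4 x y : adj M x y -> unit_entry x y ^+ 4 = 1.
Proof.
move=> xy; rewrite /unit_entry /undirected xy /=.
have i4 : 'i ^+ 4 = 1 :> C by rewrite (exprM _ 2 2) sqrCi sqrrN expr1n.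
by case: (Defs.arc M x y); case: (Defs.arc M y x); rewrite /= ?expr1n ?i4 //
  (exprM _ 2 2) sqrrN -exprM i4.
Qed.

(** The two factors are both 1, or they are ['i] and [- 'i]; this is why an edge or arc contributes
    no sign of its own. *)
Lemma unit_entryC x y : adj M x y -> unit_entry x y * unit_entry y x = 1.
Proof.
move=> xy; rewrite /unit_entry /undirected [adj M y x]adj_sym xy /=.
have := @arc_asym _ M x y.
case: (Defs.arc M x y); case: (Defs.arc M y x) => /= H0;
  rewrite ?mulr1 // ?mulrN ?mulNr -?expr2 ?sqrCi ?opprK //.
by have := H0 isT.
Qed.

Lemma degree_gt0 x y : adj M x y -> (0 < degree M x)%N.
Proof. by move=> xy; apply/card_gt0P; exists y; rewrite inE. Qed.

Definition degree_weight A : C := \prod_(v in A) (1 / (degree M v)%:R).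

Definition orbit_value s A : C := \prod_(v in A) H v (s v).

Lemma prod_porbit s x (F : 'I_n -> C) :
  \prod_(v in porbit s x) F (s v) = \prod_(v in porbit s x) F v.
Proof.
rewrite [RHS](reindex_inj (@perm_inj _ s)).
by apply: eq_bigl => v; rewrite porbit_next.
Qed.

(** Each vertex receives its inverse root degree twice, once as a source and once as a target;
    reindexing by [s] pairs the two. *)
Lemma orbit_valueE s x : orbit_value s (porbit s x) =
  (\prod_(v in porbit s x) unit_entry v (s v)) * degree_weight (porbit s x).
Proof.
rewrite /orbit_value (eq_bigr _ (fun v _ => hermitian_randicE v (s v))).
rewrite !big_split /= (prod_porbit s x (fun v => (sqrtC (degree M v)%:R)^-1)).
rewrite -big_split /=; congr (_ * _); apply: eq_bigr => v _.
by rewrite -invfM -expr2 sqrtCK div1r.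
Qed.

Lemma orbit_valueV s x :
  \prod_(v in porbit s x) H v (s^-1%g v) = (orbit_value s (porbit s x))^*.
Proof.
rewrite -(prod_porbit s x (fun v => H v (s^-1%g v))) rmorph_prod /=.
by apply: eq_bigr => v _; rewrite permK hermitian_randic_conj.
Qed.

Lemma degree_weight_gt0 s x : {in porbit s x, forall v, adj M v (s v)} ->
  0 < degree_weight (porbit s x).
Proof.
move=> adj_s; apply: prodr_gt0 => v /adj_s vs.
by rewrite div1r invr_gt0 ltr0n (degree_gt0 vs).
Qed.

Lemma orbit_valueP s x : {in porbit s x, forall v, adj M v (s v)} ->
  exists2 e : C, e ^+ 4 = 1 & orbit_value s (porbit s x) = e * degree_weight (porbit s x).
Proof.
move=> adj_s; rewrite orbit_valueE.
exists (\prod_(v in porbit s x) unit_entry v (s v)) => //.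
by rewrite -prodrXl; apply: big1 => v /adj_s /unit_entry4.
Qed.

(** Here [e ^+ 2] is 1 or -1. For [e] equal to 1 or -1 the sum doubles; for ['i] and [- 'i] the
    conjugates cancel. *)
Lemma real_fourth_root (e d : C) : e ^+ 4 = 1 -> 0 < d ->
  e * d + (e * d)^* =
  if e * d \is Num.real then (-1) ^+ (e * d == -1 * d) * 2%:R * d else 0.
Proof.
move=> e4 d0; have dn0 : d != 0 by rewrite gt_eqF.
have dR : d \is Num.real by rewrite realE ltW.
have eE : (e * d \is Num.real) = (e \is Num.real).
  apply/idP/idP => eR; last exact: realM.
  by rewrite -(mulfK dn0 e) realM // realV.
rewrite eE (inj_eq (mulIf dn0)) rmorphM /= (conj_Creal dR) -mulrDl.
have /eqP : (e ^+ 2 - 1) * (e ^+ 2 + 1) = 0.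
  by rewrite -subr_sqr -exprM e4 expr1n subrr.
rewrite mulf_eq0 subr_eq0 addr_eq0 => /orP[|].
  rewrite sqrf_eq1 => /orP[]/eqP ->.
    rewrite real1 conjC1 (_ : (1 == -1) = false) ?mul1r //.
    by rewrite -addr_eq0 (pnatr_eq0 C 2).
  by rewrite realN real1 conjCN1 eqxx expr1 mulN1r -opprD.
move=> /eqP e2; case: ifPn => [eR|_].
  (* A real number has no negative square. *)
  by have := real_exprn_even_ge0 eR (isT : ~~ odd 2); rewrite e2 oppr_ge0 ler10.
have : (e == 'i) || (e == - 'i) by rewrite -eqf_sqr e2 sqrCi.
by case/orP => /eqP ->; rewrite ?rmorphN /= conjCi ?opprK ?subrr ?addNr mul0r.
Qed.

Lemma cycle_value_next c A (f : 'I_n -> 'I_n) : uniq c -> A = [set x in c] ->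
  {in A, next c =1 f} -> cycle_value C M c = \prod_(v in A) H v (f v).
Proof.
move=> cU cA cf; rewrite /cycle_value big_uniq //=.
rewrite cA; apply: eq_big => v; first by rewrite inE.
by move=> vc; rewrite cf // cA inE.
Qed.

Lemma cycle_value_orbit s x c : x \in perm_support s ->
  traverses (perm_graph s) (porbit s x) c ->
  cycle_value C M c = orbit_value s (porbit s x) \/
  cycle_value C M c = (orbit_value s (porbit s x))^*.
Proof.
move=> xs tc; have /and4P[_ cU /eqP cA _] := tc.
have [cE|cE] := traverses_orient xs tc; rewrite (cycle_value_next cU cA cE).
  by left.
by right; apply: orbit_valueV.
Qed.

Definition real_component (S : subgraph n) A :=
  [forall c : #|A|.-tuple 'I_n, traverses S A c ==> real_cycle C M c].

Definition negative_component (S : subgraph n) A :=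
  [exists c : #|A|.-tuple 'I_n, traverses S A c && negative_cycle C M c].

(** Every traversal has the orbit value or its conjugate. Being real, and being equal to the real
    number [-1 * degree_weight], are invariant under conjugation, so the trajectory of [s] decides
    both. *)
Lemma long_component_sign s x : x \in perm_support s -> (2 < #|porbit s x|)%N ->
  (real_component (perm_graph s) (porbit s x) =
     (orbit_value s (porbit s x) \is Num.real)) *
  (negative_component (perm_graph s) (porbit s x) =
     (orbit_value s (porbit s x) == -1 * degree_weight (porbit s x))).
Proof.
move=> xs x3; have c_size : size (traject s x #|porbit s x|) == #|porbit s x|.
  by rewrite size_traject.
pose c0 := Tuple c_size; have tc0 := traverses_traject xs x3.
have weightE c : traverses (perm_graph s) (porbit s x) c ->
    \prod_(v <- c) (1 / (degree M v)%:R) = degree_weight (porbit s x).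
  case/and4P=> _ cU /eqP -> _; rewrite big_uniq //=.
  by apply: eq_bigl => v; rewrite inE.
have c0E : cycle_value C M c0 = orbit_value s (porbit s x).
  have /and4P[_ cU /eqP cA _] := tc0.
  by apply: (cycle_value_next cU cA) => v vx; rewrite next_traject_porbit.
have wR : (-1 * degree_weight (porbit s x))^* = -1 * degree_weight (porbit s x).
  rewrite rmorphM /= conjCN1 geC0_conj //; apply: prodr_ge0 => v _.
  by rewrite div1r invr_ge0 ler0n.
split.
  apply/forallP/idP => [/(_ c0)|vR c]; first by rewrite tc0 /real_cycle c0E.
  apply/implyP => /(cycle_value_orbit xs) cE; rewrite /real_cycle.
  by case: cE => ->; rewrite ?CrealJ.
apply/existsP/idP => [[c /andP[tc]]|vN]; last first.
  by exists c0; rewrite tc0 /negative_cycle c0E weightE.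
rewrite /negative_cycle weightE //; case: (cycle_value_orbit xs tc) => -> // /eqP E.
by rewrite -wR -E conjCK.
Qed.

Lemma component_value s x : x \in perm_support s ->
  {in porbit s x, forall v, adj M v (s v)} ->
  (if (2 < #|porbit s x|)%N then \prod_(v in porbit s x) H v (s^-1%g v) else 0) +
    orbit_value s (porbit s x) =
  if real_component (perm_graph s) (porbit s x)
  then (-1) ^+ negative_component (perm_graph s) (porbit s x) *
       2%:R ^+ cycle_component (perm_graph s) (porbit s x) *
       degree_weight (porbit s x)
  else 0.
Proof.
move=> xs adj_s; rewrite cycle_component_graph //; case: ltnP => [x3|x2].
  rewrite !long_component_sign // orbit_valueV addrC.
  have [e e4 ->] := orbit_valueP adj_s.
  exact: real_fourth_root (degree_weight_gt0 adj_s).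
(* An orbit of two points has no traversal, hence is vacuously real and never negative. *)
have no_cycle c : traverses (perm_graph s) (porbit s x) c = false.
  apply/negP => /and4P[c3 cU /eqP cA _].
  by rewrite leqNgt cA cardsE (card_uniqP cU) c3 in x2.
have -> : real_component (perm_graph s) (porbit s x).
  by apply/forallP => c; rewrite no_cycle.
have -> : negative_component (perm_graph s) (porbit s x) = false.
  by apply/existsP => -[c]; rewrite no_cycle.
rewrite add0r !mul1r /orbit_value.
have xsE : s (s x) = x.
  by move: x2; rewrite card_porbit_le2 // => /eqP <-; rewrite permKV.
have sx : s x != x by rewrite inE in xs.
have xE : porbit s x = [set x; s x].
  apply/esym/eqP; rewrite eqEcard subUset !sub1set porbit_next porbit_id /=.
  by rewrite cards2 eq_sym sx.
rewrite /degree_weight xE !big_setU1 ?inE 1?eq_sym // !big_set1 xsE /=.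
have xsx := adj_s _ (porbit_id s x).
rewrite !hermitian_randicE mulrACA unit_entryC // !mul1r.
by rewrite [X in _ * X = _]mulrC mulrACA -!expr2 !exprVn !sqrtCK.
Qed.

End Values.

(** * From permutations to elementary subgraphs *)

Lemma prod_expr_bool (R : pzSemiRingType) (I : finType) (P : {pred I}) (b : pred I) (x : R) :
  \prod_(i in P) x ^+ b i = x ^+ #|[set i in P | b i]|.
Proof.
by rewrite prodrXr -sum1dep_card big_mkcondr.
Qed.

Lemma real_elementaryE (C : numClosedFieldType) (n : nat) (M : mixed_graph n) S :
  real_elementary M S C =
  elementary M S && [forall A in components S, real_component C M S A].
Proof. by []. Qed.

(** All permutations with graph [S] share the sign given by its rank, and the remaining sum factors
    over the components. A single non-real cycle makes it vanish. *)
Lemma sum_elementary_fiber (C : numClosedFieldType) (n : nat) (M : mixed_graph n)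
    (S : subgraph n) : elementary M S ->
  \sum_(s : {perm 'I_n} | perm_graph s == S)
     (-1) ^+ s * \prod_(v in perm_support s) hermitian_randic C M v (s v) =
  if real_elementary M S C then
    (-1) ^+ (rank S + num_negative_cycles M S C) * 2%:R ^+ num_cycles S *
    \prod_(v in S.1) (1 / (degree M v)%:R)
  else 0.
Proof.
move=> elS; have [s Ss] := elementary_perm_graph elS.
have adj_s : {in perm_support s, forall v, adj M v (s v)}.
  by apply/forall_inP; rewrite -elementary_graph -Ss.
transitivity ((-1) ^+ rank S * \sum_(t : {perm 'I_n} | perm_graph t == S)
    \prod_(v in perm_support s) hermitian_randic C M v (t v)).
  rewrite mulr_sumr; apply: eq_bigr => t /eqP tS.
  rewrite odd_perm_rank signr_odd tS.
  by have [-> _] : perm_graph t = perm_graph s by rewrite tS.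
rewrite Ss sum_perm_graph -Ss.
rewrite (eq_bigr (fun A => if real_component C M S A
  then (-1) ^+ negative_component C M S A * 2%:R ^+ cycle_component S A *
       degree_weight C M A else 0)); last first.
  move=> A; rewrite Ss => /component_graphP[x xs ->].
  apply: component_value => // v vx; apply: adj_s.
  by rewrite (porbit_support vx).
rewrite real_elementaryE elS /=.
case: (boolP [forall A in _, _]) => [/forall_inP SR|]; last first.
  rewrite negb_forall_in => /exists_inP[A AS /negPf AN].
  by rewrite (bigD1 A) //= AN mul0r mulr0.
rewrite exprD -!mulrA; congr (_ * _).
under eq_bigr => A AS do rewrite (SR A AS).
rewrite -/(degree_weight C M S.1) !big_split /= mulrA.
congr (_ * _ * _).
- exact: prod_expr_bool.
- exact: prod_expr_bool.
- by rewrite /degree_weight [RHS](set_partition_big _ (partition_components S)).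
Qed.

Theorem theorem2p2 (C : numClosedFieldType) (n : nat) (M : mixed_graph n)
    (a : nat -> C)
    (ha : char_poly (hermitian_randic C M) =
          'X^n + \sum_(1 <= k < n.+1) a k *: 'X^(n - k))
    (k : nat) (hk : (1 <= k <= n)%N) :
  (-1) ^+ k * a k =
  \sum_(S : subgraph n | real_elementary M S C && (#|S.1| == k))
     (-1) ^+ (rank S + num_negative_cycles M S C) * 2%:R ^+ num_cycles S *
     \prod_(v in S.1) (1 / (degree M v)%:R).
Proof.
case/andP: hk => k_gt0 kn.
(* As [k] is positive, ['X^n] does not reach degree [n - k], and among the indices up to [n] only
   [k] does. *)
have -> : a k = (char_poly (hermitian_randic C M))`_(n - k).
  rewrite ha coefD coefXn coef_sum (bigD1_seq k) ?iota_uniq //=; last first.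
    by rewrite mem_index_iota k_gt0 ltnS.
  rewrite coefZ coefXn eqxx mulr1 big_nat_cond big1 ?addr0 => [|j].
    by rewrite ltn_eqF ?add0r // ltn_subrL k_gt0 (leq_trans k_gt0).
  case/andP=> /andP[j_gt0 jn] jk; rewrite coefZ coefXn.
  case: eqP => [E|_]; last by rewrite mulr0.
  by rewrite -(subKn kn) E subKn ?eqxx // in jk.
rewrite coef_char_poly_zero_diag // => [|i]; last first.
  by rewrite hermitian_randic_nonadj // adj_irrefl.
(* A permutation whose graph is not elementary moves some vertex to a non-neighbour, so its product
   vanishes; the others are grouped by their graph. *)
rewrite (bigID (fun s => elementary M (perm_graph s))) /= [X in _ + X]big1 ?addr0.
  rewrite (partition_big (@perm_graph n)
    (fun S => elementary M S && (#|S.1| == k))) => [|s /andP[-> ->]] //.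
  rewrite big_mkcond [RHS]big_mkcond; apply: eq_bigr => S _.
  (* Elementary subgraphs that are not real remain at this point; their fibre sums are zero. *)
  case: ifPn => [/andP[elS Sk]|]; last first.
    by rewrite real_elementaryE; case: (elementary M S) => //= /negPf ->; rewrite andbF.
  rewrite Sk andbT -(sum_elementary_fiber C elS); apply: eq_bigl => s.
  apply/andP/idP => [[] //|/eqP sS]; split; last exact/eqP.
  by rewrite sS elS andbT -(eqP Sk) -sS.
move=> s /andP[_]; rewrite elementary_graph negb_forall_in => /exists_inP[v vs sv].
by rewrite (bigD1 v) //= hermitian_randic_nonadj // mul0r mulr0.
Qed.
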